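(* Let $\mathbb{T}$ be a time scale, let $a,b\in\mathbb{T}$ with $a<b$, let $I\subset\mathbb{R}$ be an interval, and let $F:I\to\mathbb{R}$ be a convex function on $I$. Let $x,p:[a,b]_{\mathbb{T}}\to I$ be rd-continuous with $p$ nonnegative on $[a,b]_{\mathbb{T}}$, and let $g:[a,b]_{\mathbb{T}}\to I$ be non-decreasing on $[a,b]_{\mathbb{T}}$. Suppose that $A:=\int_a^b p(t)\,\Delta g(t)>0$. Then $$\frac1A\int_a^b p(t)F(x(t))\,\Delta g(t)\;\geq\;F\left(\frac1A\int_a^b p(t)x(t)\,\Delta g(t)\right),$$ provided both integrals exist.
   Context: A time scale $\mathbb{T}$ is a nonempty closed subset of $\mathbb{R}$, and $[a,b]_{\mathbb{T}}:=[a,b]\cap\mathbb{T}$, $[a,b)_{\mathbb{T}}:=[a,b)\cap\mathbb{T}$. A function on a time scale is rd-continuous if it is continuous at every right-dense point (a point that is a limit of points of the time scale from the right) and has finite left-sided limits at every left-dense point (a point that is a limit of points of the time scale from the left). Riemann--Stieltjes $\Delta$-integral: let $f,g$ be bounded real-valued functions on $[a,b]_{\mathbb{T}}$ with $g$ non-decreasing on $[a,b]_{\mathbb{T}}$. A partition of $[a,b]_{\mathbb{T}}$ is a finite set $P=\{t_0,\dots,t_n\}\subset[a,b]_{\mathbb{T}}$ with $a=t_0<t_1<\dots<t_n=b$; a partition $P\supset P^*$ is called a refinement of $P^*$. For a selection $X=\{x_1,\dots,x_n\}$ with $x_i\in[t_{i-1},t_i)_{\mathbb{T}}$ put $S_g(f,P,X)=\sum_{i=1}^n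 f(x_i)(g(t_i)-g(t_{i-1}))$. Then $f$ is Riemann--Stieltjes $\Delta$-integrable with respect to $g$ on $[a,b]_{\mathbb{T}}$ if there is a number $\mathcal{I}\in\mathbb{R}$ such that for every $\varepsilon>0$ there is a partition $P^*$ with $|S_g(f,P,X)-\mathcal{I}|<\varepsilon$ for all refinements $P\supset P^*$ and all selections $X$ for $P$; this (unique) number is denoted $\int_a^b f(t)\,\Delta g(t)=\mathcal{I}$.
   Formalization: Added hypothesis: if the mean m = (1/A)∫p x Δg is a boundary point of I, then m lies in I and F is continuous at m relative to I; without it the claim fails when F jumps at an endpoint of I, or F(m) is undefined. *)

(* Defs.v *)
From HB Require Import structures.
From mathcomp Require Import all_boot all_order all_algebra.
From mathcomp Require Import all_classical all_reals all_analysis.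

Set Implicit Arguments.
Unset Strict Implicit.
Unset Printing Implicit Defensive.
Import Order.TTheory GRing.Theory Num.Theory.
Import numFieldNormedType.Exports.
Local Open Scope classical_set_scope.
Local Open Scope ring_scope.

Definition time_scale (R : realType) (T : set R) : Prop :=
  T !=set0 /\ closed T.

Definition ts_cc (R : realType) (T : set R) (a b : R) : set R :=
  [set t | t \in `[a, b]] `&` T.

Definition ts_co (R : realType) (T : set R) (a b : R) : set R :=
  [set t | t \in `[a, b[] `&` T.

Definition right_dense (R : realType) (S : set R) (t : R) : Prop :=
  limit_point (S `&` [set s | t < s]) t.

Definition left_dense (R : realType) (S : set R) (t : R) : Prop :=
  limit_point (S `&` [set s | s < t]) t.

(* A function on S is represented by a total function whose values outside
   of S are irrelevant: all limits are taken along S. *)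
Definition rd_continuous (R : realType) (S : set R) (f : R -> R) : Prop :=
  forall t, S t ->
    (right_dense S t -> f s @[s --> within S (nbhs t)] --> f t) /\
    (left_dense S t -> exists l : R, f s @[s --> within S t^'-] --> l).

Definition nondecreasing_on (R : realType) (S : set R) (g : R -> R) : Prop :=
  forall s t, S s -> S t -> s <= t -> g s <= g t.

(* The partition a = t_0 < t_1 < ... < t_n = b is represented by
   P = [:: t_1; ...; t_n], so that t_i = nth b (a :: P) i. *)
Definition ts_partition (R : realType) (T : set R) (a b : R) (P : seq R) : Prop :=
  itv_partition a b P /\ (forall t, t \in a :: P -> ts_cc T a b t).

(* Numbered from 0: xi i is the point selected in [t_i, t_(i+1)). *)
Definition ts_selection (R : realType) (T : set R) (a b : R) (P : seq R)
    (xi : nat -> R) : Prop :=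
  let t := nth b (a :: P) in
  forall i, (i < size P)%N -> ts_co T (t i) (t i.+1) (xi i).

Definition RS_sum (R : realType) (a b : R) (g f : R -> R) (P : seq R)
    (xi : nat -> R) : R :=
  let t := nth b (a :: P) in
  \sum_(0 <= i < size P) f (xi i) * (g (t i.+1) - g (t i)).

Definition is_RS_delta_integral (R : realType) (T : set R) (a b : R)
    (g f : R -> R) (l : R) : Prop :=
  [/\ [bounded f t | t in ts_cc T a b],
      [bounded g t | t in ts_cc T a b],
      nondecreasing_on (ts_cc T a b) g &
      forall e : R, 0 < e ->
        exists P0 : seq R, ts_partition T a b P0 /\
          forall (P : seq R) (xi : nat -> R),
            ts_partition T a b P -> {subset P0 <= P} ->
            ts_selection T a b P xi ->
            `|RS_sum a b g f P xi - l| < e].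

Definition RS_delta_integrable (R : realType) (T : set R) (a b : R)
    (g f : R -> R) : Prop :=
  exists l : R, is_RS_delta_integral T a b g f l.

(* The default value is 0, so a positive integral implies integrability. *)
Definition RS_delta_integral (R : realType) (T : set R) (a b : R)
    (g f : R -> R) : R :=
  xget 0 [set l | is_RS_delta_integral T a b g f l].

(* Main.v *)
Require Import Defs.
From HB Require Import structures.
From mathcomp Require Import all_boot all_order all_algebra.
From mathcomp Require Import all_classical all_reals all_analysis.
From mathcomp Require Import ring lra.
Import Order.TTheory GRing.Theory Num.Theory.
Import numFieldNormedType.Exports.
Local Open Scope classical_set_scope.
Local Open Scope ring_scope.

(** The integral inequality is the finite Jensen inequality for
    Riemann-Stieltjes sums, passed to the limit.

    Fix a partition and a selection [xi], and give the value [x (xi i)] the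
    weight [p (xi i) * (g t_(i+1) - g t_i)], which is nonnegative because [p] is
    and [g] is non-decreasing.  The sums for [p], [p * x] and [p * (F \o x)] are
    then the total weight, the weighted sum of the values of [x], and the
    weighted sum of their images under [F], so finite Jensen relates the three
    ([RS_sum_jensen]).  Each integral is a limit along refinements; common
    refinements of finitely many partitions exist, hence one sequence of
    partitions and selections realizes all three integrals at once
    ([is_RS_delta_integral_cvg]).

    In the limit the weighted means of [x], which lie in [I], converge to
    [m = (1/A) * int p x], so [m] is in the closure of [I].  To bound [F m] by the
    limit of the values of [F] at these means, it is enough that [F] is lower
    semicontinuous at [m] along [I] ([convex_function_jensen_limit]).  At an
    interior point of [I] this follows from convexity, as the graph of [F] stays
    above the extension of any of its chords
    ([convex_function_lsc_interior]); at a boundary point it is part of the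
    continuity hypothesis, which also provides [m \in I]. *)

(** * Convex functions on an interval *)

(** Convexity with weights that need not add up to [1]: Jensen's inequality
    is proved by adding one weight at a time, and partial sums of the weights are
    not normalized. *)
Lemma convex_function_weighted_mean (R : realType) (I : interval R)
    (F : R -> R) (s t u v z : R) :
  convex_function [set` I] F -> u \in I -> v \in I ->
  0 <= s -> 0 <= t -> 0 < s + t -> s * u + t * v = (s + t) * z ->
  z \in I /\ (s + t) * F z <= s * F u + t * F v.
Proof.
move=> cF uI vI s0 t0 st0 hz.
have stN0 : s + t != 0 by rewrite gt_eqF.
have k0 : 0 <= s / (s + t) by rewrite divr_ge0 // ltW.
have k1 : s / (s + t) <= 1 by rewrite ler_pdivrMr // mul1r lerDl.
have zE : z = s / (s + t) * u + (1 - s / (s + t)) * v.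
  by apply: (mulfI stN0); rewrite -hz; field.
split.
  have iI := @interval_is_interval R I.
  have [uv|vu] := leP u v.
    by apply: (iI u v) => //; apply/andP; split; nra.
  by apply: (iI v u) => //; apply/andP; split; nra.
have : F (s / (s + t) * u + (1 - s / (s + t)) * v) <=
    s / (s + t) * F u + (1 - s / (s + t)) * F v.
  by apply: (cF (Itv01 k0 k1)); rewrite inE.
rewrite -zE => Fz; rewrite -(ler_pM2l st0) in Fz; apply: (le_trans Fz).
by rewrite le_eqVlt; apply/orP; left; apply/eqP; field.
Qed.

(** The finite Jensen inequality.  The mean [c] is characterized by a product
    rather than a quotient, so that a zero total weight needs no exception: it
    makes every weighted sum vanish, and then any point of [I] serves as [c]. *)
Lemma convex_function_jensen (R : realType) (I : interval R) (F : R -> R)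
    (n : nat) (w y : nat -> R) :
  convex_function [set` I] F -> (exists c0, c0 \in I) ->
  (forall i, (i < n)%N -> 0 <= w i /\ y i \in I) ->
  exists c : R, [/\ c \in I,
    \sum_(0 <= i < n) w i * y i = (\sum_(0 <= i < n) w i) * c &
    (\sum_(0 <= i < n) w i) * F c <= \sum_(0 <= i < n) w i * F (y i)].
Proof.
move=> cF [c0 c0I]; elim: n => [_|n ih wy].
  by exists c0; rewrite !big_geq // !mul0r.
have [|c [cI cE cF_le]] := ih; first by move=> i /ltnW; exact: wy.
have [wn0 ynI] := wy n (ltnSn n).
have W0 : 0 <= \sum_(0 <= i < n) w i.
  by rewrite big_nat sumr_ge0 // => i /= iltn; case: (wy i (ltnW iltn)).
rewrite !big_nat_recr //= cE; set W := \sum_(0 <= i < n) w i in W0 cF_le *.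
have [Wwn|] := ltP 0 (W + w n).
  have [|zI Fz] := @convex_function_weighted_mean _ I F W (w n) c (y n)
    ((W * c + w n * y n) / (W + w n)) cF cI ynI W0 wn0 Wwn.
    by rewrite mulrCA divff ?mulr1 // gt_eqF.
  exists ((W * c + w n * y n) / (W + w n)); split => //.
    by rewrite mulrCA divff ?mulr1 // gt_eqF.
  by apply: (le_trans Fz); rewrite lerD2r.
(* The total weight is zero, so the mean of the previous stage still works. *)
move=> Wwn; have {W0 Wwn}[W0 w0] : W = 0 /\ w n = 0 by split; lra.
by exists c; rewrite W0 w0 in cF_le *; split => //; lra.
Qed.

(** The sign condition says that [m] lies strictly between [u] and [y], in either
    order: beyond [m], the graph is above the line through [u] and [m], since
    otherwise [F m] would exceed the chord from [u] to [y]. *)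
Lemma convex_function_chord_extension (R : realType) (I : interval R)
    (F : R -> R) (u m y : R) :
  convex_function [set` I] F -> u \in I -> y \in I ->
  0 < (y - m) * (m - u) -> F m + (y - m) * ((F m - F u) / (m - u)) <= F y.
Proof.
move=> cF uI yI.
have [um|mu|->] := ltgtP u m; last by rewrite subrr mulr0 ltxx.
- have mu0 : 0 < m - u by lra.
  rewrite pmulr_lgt0 // => ym0.
  have [||_] := @convex_function_weighted_mean _ I F (y - m) (m - u) u y m
    cF uI yI (ltW ym0) (ltW mu0); [by lra|by ring|].
  by move=> Fm; rewrite mulrA -lerBrDl ler_pdivrMr //; nra.
- have mu0 : 0 < u - m by lra.
  rewrite -mulrNN pmulr_lgt0 ?opprB // => ym0.
  have [||_] := @convex_function_weighted_mean _ I F (m - y) (u - m) u y m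
    cF uI yI (ltW ym0) (ltW mu0); [by lra|by ring|].
  rewrite -[m - u]opprB invrN mulrN -mulNr opprB => Fm.
  by rewrite mulrA -lerBrDl ler_pdivrMr //; nra.
Qed.

(** Choose points of [I] on both sides of [m].  The line through [m] and the
    point on one side bounds [F] from below on the other side, and both lines
    take the value [F m] at [m]. *)
Lemma convex_function_lsc_interior (R : realType) (I : interval R)
    (F : R -> R) (m : R) :
  convex_function [set` I] F -> interior [set` I] m ->
  forall e, 0 < e -> \forall y \near within [set` I] (nbhs m), F m - e < F y.
Proof.
move=> cF mI e e0.
have [r /= r0 rI] := (iffLR (nbhs_ballP m [set` I])) mI.
have near_m (d : R) : `|d| < r -> m + d \in I.
  by move=> dr; apply: rI; rewrite /ball /= opprD addrA subrr sub0r normrN.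
have uI : m - r / 2 \in I by rewrite near_m // normrN gtr0_norm; lra.
have vI : m + r / 2 \in I by rewrite near_m // gtr0_norm; lra.
have affine (k : R) : \forall y \near nbhs m, F m - e < F m + (y - m) * k.
  have : F m + (y - m) * k @[y --> m] --> F m + (m - m) * k.
    apply: cvgD; first exact: cvg_cst.
    by apply: cvgMr_tmp; apply: cvgB; [exact: cvg_id|exact: cvg_cst].
  by rewrite subrr mul0r addr0 => /cvgr_gt; apply; lra.
rewrite near_withinE.
near=> y => /= yI.
have [ym|my|->] := ltgtP y m; last by lra.
- apply: (@lt_le_trans _ _
    (F m + (y - m) * ((F m - F (m + r / 2)) / (m - (m + r / 2))))).
    by near: y; exact: affine.
  by apply: (convex_function_chord_extension _ _ _ _ _ _ cF) => //; nra.
- apply: (@lt_le_trans _ _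
    (F m + (y - m) * ((F m - F (m - r / 2)) / (m - (m - r / 2))))).
    by near: y; exact: affine.
  by apply: (convex_function_chord_extension _ _ _ _ _ _ cF) => //; nra.
Unshelve. all: by end_near. Qed.

(** Passage to the limit in Jensen's inequality.  For large [n] the quotients
    [b n / a n] are means in [I], and they converge to [B / A]; lower
    semicontinuity at [B / A] is the half of continuity that carries the
    inequality to the limit.  It is asked for only after [B / A] is known to be in
    the closure of [I], because the reason for it depends on the position of
    [B / A]. *)
Lemma convex_function_jensen_limit (R : realType) (I : interval R)
    (F : R -> R) (A B C : R) (a b c : nat -> R) :
  a n @[n --> \oo] --> A -> b n @[n --> \oo] --> B -> c n @[n --> \oo] --> C ->
  0 < A ->
  (forall n, exists z, [/\ z \in I, b n = a n * z & a n * F z <= c n]) ->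
  closure [set` I] (1 / A * B) /\
  ((forall e, 0 < e ->
     \forall y \near within [set` I] (nbhs (1 / A * B)), F (1 / A * B) - e < F y) ->
   F (1 / A * B) <= 1 / A * C).
Proof.
move=> aA bB cC A0 abc; have [z zP] := choice abc.
have a0 : \forall n \near \oo, 0 < a n by apply: (cvgr_gt A).
have cvg_quot (u : nat -> R) (U : R) : u n @[n --> \oo] --> U ->
    1 / a n * u n @[n --> \oo] --> 1 / A * U.
  move=> uU; under eq_fun do rewrite div1r; rewrite div1r.
  by apply: cvgM => //; apply: cvgV => //; rewrite gt_eqF.
have zm : z n @[n --> \oo] --> 1 / A * B.
  apply: cvg_trans (cvg_quot _ _ bB); apply: near_eq_cvg.
  near=> n; have [_ -> _] := zP n; rewrite div1r mulKf // gt_eqF //.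
  by near: n.
split.
  apply: (closed_cvg (closure [set` I]) (@closed_closure _ _) _ _ zm).
  by near=> n; apply: subset_closure; case: (zP n).
move=> lsc; apply/ler_addgt0Pr => e e0; rewrite -lerBlDr.
apply: (ler_cvg_to (cvg_cst _) (cvg_quot _ _ cC)).
have Fz : \forall n \near \oo, [set` I] (z n) -> F (1 / A * B) - e < F (z n).
  exact: zm (lsc e e0).
near=> n; have [zI _ zle] := zP n.
apply: (@le_trans _ _ (F (z n))).
  by apply/ltW; move: zI; near: n.
rewrite div1r -ler_pdivrMl ?invr_gt0 ?invrK //.
  by near: n.
Unshelve. all: by end_near. Qed.

(** * Riemann-Stieltjes sums and their limits *)

Lemma ts_partition_common_refinement (R : realType) (T : set R) (a b : R)
    (J : finType) (Q : J -> seq R) :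
  T a -> T b -> a < b -> (forall j, ts_partition T a b (Q j)) ->
  exists P, ts_partition T a b P /\ forall j, {subset Q j <= P}.
Proof.
move=> Ta Tb ab QP.
(* [b] is added by hand to cover an empty family. *)
pose s := undup (b :: flatten [seq Q j | j : J]).
pose P := sort <=%O s.
have subP j : {subset Q j <= P}.
  move=> t tQ; rewrite mem_sort mem_undup inE; apply/orP; right.
  by apply/flatten_mapP; exists j => //; rewrite mem_enum.
have bP : b \in P by rewrite mem_sort mem_undup mem_head.
have Pin t : t \in P -> a < t /\ ts_cc T a b t.
  rewrite mem_sort mem_undup inE => /orP[/eqP ->|/flatten_mapP[j _ tQ]].
    by split => //; split => //=; rewrite in_itv /= lexx ltW.
  have [[aQ _] QT] := QP j; split; last by apply: QT; rewrite inE tQ orbT.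
  by have /allP := order_path_min lt_trans aQ; apply.
have aP : path <%O a P.
  rewrite path_min_sorted; last by apply/allP => t /Pin[].
  by rewrite sort_lt_sorted undup_uniq.
have Pin' t : t \in a :: P -> ts_cc T a b t.
  rewrite inE => /predU1P[->|/Pin[]//].
  by split; rewrite //= in_itv /= lexx ltW.
exists P; split => //; split => //; split => //.
have lastP : last a P <= b.
  by have [/= + _] := Pin' _ (mem_last a P); rewrite in_itv /= => /andP[].
rewrite eq_le lastP /=; case/splitPr: bP aP => p1 p2.
by rewrite cat_path last_cat /= => /and3P[_ _ /unstable.path_lt_le_last].
Qed.

Lemma ts_selection_left_endpoints (R : realType) (T : set R) (a b : R)
    (P : seq R) :
  ts_partition T a b P -> ts_selection T a b P (nth b (a :: P)).
Proof.
move=> [[/(pathP b) aP _] PT] t i iP; split.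
  by rewrite /= in_itv /= lexx; exact: aP.
by case: (PT (nth b (a :: P) i)) => //; rewrite mem_nth //= ltnS ltnW.
Qed.

(** Finitely many integrals with respect to the same [g] are limits of sums over
    one sequence of partitions and selections: at stage [n], refine the partitions
    that make each sum [1/(n+1)]-close to its integral.  This turns a limit along
    refinements into ordinary limits of sequences, which can be combined. *)
Lemma is_RS_delta_integral_cvg (R : realType) (T : set R) (a b : R)
    (g : R -> R) (J : finType) (f : J -> R -> R) (l : J -> R) :
  T a -> T b -> a < b -> (forall j, is_RS_delta_integral T a b g (f j) (l j)) ->
  exists (P : nat -> seq R) (xi : nat -> nat -> R),
    (forall n, ts_partition T a b (P n) /\ ts_selection T a b (P n) (xi n)) /\
    forall j, RS_sum a b g (f j) (P n) (xi n) @[n --> \oo] --> l j.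
Proof.
move=> Ta Tb ab fl.
have step n : exists P, ts_partition T a b P /\ forall j,
    `|RS_sum a b g (f j) P (nth b (a :: P)) - l j| < n.+1%:R^-1.
  have approx j : exists Q, ts_partition T a b Q /\
      forall P xi, ts_partition T a b P -> {subset Q <= P} ->
        ts_selection T a b P xi -> `|RS_sum a b g (f j) P xi - l j| < n.+1%:R^-1.
    by case: (fl j) => _ _ _; apply; rewrite invr_gt0 ltr0n.
  have [Q QP] := choice approx.
  have [P [PP QsubP]] :=
    ts_partition_common_refinement _ _ _ _ _ _ Ta Tb ab (fun j => (QP j).1).
  exists P; split => // j; apply: (QP j).2 => //.
  exact: ts_selection_left_endpoints.
have [P PP] := choice step.
exists P, (fun n => nth b (a :: P n)); split.
  by move=> n; have [Pn _] := PP n; split; [|exact: ts_selection_left_endpoints].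
move=> j; apply/cvgrPdist_lt => e e0.
near=> n; rewrite distrC; apply: (lt_trans ((PP n).2 j)).
by near: n; exact: near_infty_natSinv_lt (PosNum e0).
Unshelve. all: by end_near. Qed.

Lemma RS_delta_integralP (R : realType) (T : set R) (a b : R) (g f : R -> R) :
  RS_delta_integrable T a b g f ->
  is_RS_delta_integral T a b g f (RS_delta_integral T a b g f).
Proof. by move=> [l fl]; exact: (xgetPex 0 (ex_intro _ l fl)). Qed.

(** Only an integral that exists can differ from the default value [0]; this is
    how the integrability of [p] follows from [A > 0]. *)
Lemma RS_delta_integral_neq0_integrable (R : realType) (T : set R) (a b : R)
    (g f : R -> R) :
  RS_delta_integral T a b g f != 0 -> RS_delta_integrable T a b g f.
Proof.
rewrite /RS_delta_integral; case: xgetP => [l _ fl _|_]; first by exists l.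
by rewrite eqxx.
Qed.

(** * Jensen's inequality for the integral *)

(** Finite Jensen with the weights [p (xi i) * (g t_(i+1) - g t_i)]. *)
Lemma RS_sum_jensen (R : realType) (T : set R) (a b : R) (I : interval R)
    (F x p g : R -> R) (P : seq R) (xi : nat -> R) :
  convex_function [set` I] F ->
  (forall t, ts_cc T a b t -> x t \in I /\ 0 <= p t) ->
  nondecreasing_on (ts_cc T a b) g ->
  ts_partition T a b P -> ts_selection T a b P xi ->
  exists z, [/\ z \in I,
    RS_sum a b g (fun t => p t * x t) P xi = RS_sum a b g p P xi * z &
    RS_sum a b g p P xi * F z <= RS_sum a b g (fun t => p t * F (x t)) P xi].
Proof.
move=> cF xp ndg [[/(pathP b) aP _] PT] selP.
have tT i : (i <= size P)%N -> ts_cc T a b (nth b (a :: P) i).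
  by move=> iP; apply: PT; rewrite mem_nth.
have xiT i : (i < size P)%N -> ts_cc T a b (xi i).
  move=> iP; have [] := selP i iP; rewrite /= in_itv /= => /andP[tx xt] Tx.
  split => //; rewrite /= in_itv /=.
  have [+ _] := tT i (ltnW iP); rewrite /= in_itv /= => /andP[at_ _].
  have [+ _] := tT i.+1 iP; rewrite /= in_itv /= => /andP[_ tb].
  by rewrite (le_trans at_ tx) (le_trans (ltW xt) tb).
have [|i iP|z [zI zE zle]] := @convex_function_jensen R I F (size P)
    (fun i => p (xi i) * (g (nth b (a :: P) i.+1) - g (nth b (a :: P) i)))
    (fun i => x (xi i)) cF.
- have aT : ts_cc T a b a by apply: PT; exact: mem_head.
  by exists (x a); case: (xp a aT).
- have [xI p0] := xp _ (xiT i iP); split => //.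
  rewrite mulr_ge0 // subr_ge0 ndg ?ltW //; [exact/tT/ltnW|exact: tT|].
  exact: aP.
exists z; split; rewrite // /RS_sum.
  by rewrite -zE; apply: eq_bigr => i _; rewrite mulrAC.
by apply: (le_trans zle); apply: ler_sum => i _; rewrite mulrAC.
Qed.

Theorem corollary13 (R : realType) (T : set R) (a b : R) (I : interval R)
    (F x p g : R -> R) :
  time_scale T -> T a -> T b -> a < b ->
  convex_function [set` I] F ->
  (forall t, ts_cc T a b t -> [/\ x t \in I, p t \in I & g t \in I]) ->
  rd_continuous (ts_cc T a b) x ->
  rd_continuous (ts_cc T a b) p ->
  (forall t, ts_cc T a b t -> 0 <= p t) ->
  nondecreasing_on (ts_cc T a b) g ->
  let A := RS_delta_integral T a b g p in
  let m := 1 / A * RS_delta_integral T a b g (fun t => p t * x t) in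
  0 < A ->
  RS_delta_integrable T a b g (fun t => p t * F (x t)) ->
  RS_delta_integrable T a b g (fun t => p t * x t) ->
  (* if m is a boundary point of I, it belongs to I and F is continuous at m *)
  (closure [set` I] m -> ~ interior [set` I] m ->
     m \in I /\ F y @[y --> within [set` I] (nbhs m)] --> F m) ->
  m \in I /\
  1 / A * RS_delta_integral T a b g (fun t => p t * F (x t)) >= F m.
Proof.
move=> _ Ta Tb ab cF xpgI _ _ p0 ndg A m A0 intpF intpx bdry.
have intp : RS_delta_integrable T a b g p.
  by apply: RS_delta_integral_neq0_integrable; rewrite gt_eqF.
pose fs := [:: p; fun t => p t * x t; fun t => p t * F (x t)].
have [|P [xi [Pxi cvgS]]] := @is_RS_delta_integral_cvg R T a b g 'I_3
    (fun j => nth p fs j) (fun j => RS_delta_integral T a b g (nth p fs j))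
    Ta Tb ab.
  by case=> -[|[|[|//]]] ? /=; exact: RS_delta_integralP.
have xp t : ts_cc T a b t -> x t \in I /\ 0 <= p t.
  by move=> Tt; have [xI _ _] := xpgI t Tt; split; [|exact: p0].
have [clm Fm] := convex_function_jensen_limit R I F A _ _ _ _ _
  (cvgS (@Ordinal 3 0 isT)) (cvgS (@Ordinal 3 1 isT)) (cvgS (@Ordinal 3 2 isT))
  A0 (fun n => RS_sum_jensen R T a b I F x p g (P n) (xi n)
                 cF xp ndg (Pxi n).1 (Pxi n).2).
rewrite /= -/m in clm Fm.
have [mI|mNI] := pselect (interior [set` I] m).
  split; first exact: interior_subset mI.
  exact/Fm/convex_function_lsc_interior.
have [mI Fcont] := bdry clm mNI; split => //.
by apply: Fm => e e0; apply: (cvgr_gt (F m)) => //; lra.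
Qed.
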